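(* If $\mathbf{A}=\langle A;\land,\lor,\to,\sim,',1\rangle$ is a dually hemimorphic semi-Nelson algebra, then $\mathbf{A}$ is centered, with center $1'$; that is, $\sim(1')=1'$.
   Context: **Semi-Nelson algebra**: an algebra $\mathbf{A}=\langle A;\land,\lor,\to,\sim,1\rangle$ of type $(2,2,2,1,0)$ such that, writing $x\to_N y:=x\to(x\land y)$, for all $x,y,z\in A$: (SN1) $x\land(x\lor y)=x$; (SN2) $x\land(y\lor z)=(z\land x)\lor(y\land x)$; (SN3) $\sim\sim x=x$; (SN4) $\sim(x\land y)=\sim x\lor\sim y$; (SN5) $x\land\sim x=(x\land\sim x)\land(y\lor\sim y)$; (SN6) $x\land(x\to_N y)=x\land(\sim x\lor y)$; (SN7) $x\to_N(y\to_N z)=(x\land y)\to_N z$; (SN8) $(x\to_N y)\to_N[(y\to_N x)\to_N[(x\to z)\to_N(y\to z)]]=1$; (SN9) $(x\to_N y)\to_N[(y\to_N x)\to_N[(z\to x)\to_N(z\to y)]]=1$; (SN10) $(\sim(x\to y))\to_N(x\land\sim y)=1$; (SN11) $(x\land\sim y)\to_N(\sim(x\to y))=1$. **Dually hemimorphic semi-Nelson algebra**: an algebra $\langle A;\land,\lor,\to,\sim,',1\rangle$ of type $(2,2,2,1,1,0)$ such that $\langle A;\land,\lor,\to,\sim,1\rangle$ is a semi-Nelson algebra and for all $x,y\in A$ (with $\sim x'$ meaning $\sim(x')$): (DSN1) $(\sim 1)'=1$; (DSN2) $1'\to(\sim 1)=1$; (DSN3) $((x\to y)\land(y\to x)\land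 x')\to_N((x\to y)\land(y\to x)\land y)'=1$; (DSN4) $\sim x'\to(\sim x\land(x'\to x))=1$; (DSN5) $(\sim x\land(x'\to x))\to\sim x'=1$; (DSN6) $(x\land y)'\to(x'\lor y')=1$; (DSN7) $(x'\lor y')\to(x\land y)'=1$. A semi-Nelson algebra is **centered** if it has an element $c$ with $\sim c=c$; such a $c$ is called a center (it is necessarily unique). *)

(* Defs.v *)
Declare Scope nelson_scope.
Delimit Scope nelson_scope with nelson.

Record sn_signature := SNSignature {
  sn_carrier :> Type;
  meet : sn_carrier -> sn_carrier -> sn_carrier;
  join : sn_carrier -> sn_carrier -> sn_carrier;
  imp : sn_carrier -> sn_carrier -> sn_carrier;
  neg : sn_carrier -> sn_carrier;
  one : sn_carrier
}.

Arguments meet {s} x y.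
Arguments join {s} x y.
Arguments imp {s} x y.
Arguments neg {s} x.
Arguments one {s}.

Definition impN {A : sn_signature} (x y : A) : A := imp x (meet x y).

Notation "1" := one : nelson_scope.
Notation "∼ x" := (neg x)
  (at level 30, right associativity, format "∼ x") : nelson_scope.
Notation "x ⊓ y" := (meet x y) (at level 40, left associativity) : nelson_scope.
Notation "x ⊔ y" := (join x y) (at level 50, left associativity) : nelson_scope.
Notation "x ⇒ y" := (imp x y) (at level 55, no associativity) : nelson_scope.
Notation "x ⇒_N y" := (impN x y) (at level 55, no associativity) : nelson_scope.

Open Scope nelson_scope.

Record is_semi_Nelson (A : sn_signature) : Prop := {
  SN1 : forall x y : A, x ⊓ (x ⊔ y) = x;
  SN2 : forall x y z : A, x ⊓ (y ⊔ z) = (z ⊓ x) ⊔ (y ⊓ x);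
  SN3 : forall x : A, ∼ ∼ x = x;
  SN4 : forall x y : A, ∼ (x ⊓ y) = ∼ x ⊔ ∼ y;
  SN5 : forall x y : A, x ⊓ ∼ x = (x ⊓ ∼ x) ⊓ (y ⊔ ∼ y);
  SN6 : forall x y : A, x ⊓ (x ⇒_N y) = x ⊓ (∼ x ⊔ y);
  SN7 : forall x y z : A, x ⇒_N (y ⇒_N z) = (x ⊓ y) ⇒_N z;
  SN8 : forall x y z : A,
    (x ⇒_N y) ⇒_N ((y ⇒_N x) ⇒_N ((x ⇒ z) ⇒_N (y ⇒ z))) = 1;
  SN9 : forall x y z : A,
    (x ⇒_N y) ⇒_N ((y ⇒_N x) ⇒_N ((z ⇒ x) ⇒_N (z ⇒ y))) = 1;
  SN10 : forall x y : A, (∼ (x ⇒ y)) ⇒_N (x ⊓ ∼ y) = 1;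
  SN11 : forall x y : A, (x ⊓ ∼ y) ⇒_N (∼ (x ⇒ y)) = 1
}.

Definition is_center (A : sn_signature) (c : A) : Prop := ∼ c = c.

Definition centered (A : sn_signature) : Prop := exists c : A, is_center A c.

Record dhsn_signature := DHSNSignature {
  dhsn_reduct :> sn_signature;
  prime : dhsn_reduct -> dhsn_reduct
}.

Arguments prime {d} x.

(* Binds tighter than [∼]: [∼ x^'] is [∼ (x^')]. *)
Notation "x ^'" := (prime x)
  (at level 2, left associativity, format "x ^'") : nelson_scope.

Record is_dually_hemimorphic_semi_Nelson (A : dhsn_signature) : Prop := {
  dhsn_semi_Nelson : is_semi_Nelson A;
  DSN1 : (∼ 1)^' = (1 : A);
  DSN2 : (1 : A)^' ⇒ (∼ 1) = 1;
  DSN3 : forall x y : A,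
    (((x ⇒ y) ⊓ (y ⇒ x)) ⊓ x^') ⇒_N (((x ⇒ y) ⊓ (y ⇒ x)) ⊓ y)^' = 1;
  DSN4 : forall x : A, (∼ x^') ⇒ (∼ x ⊓ (x^' ⇒ x)) = 1;
  DSN5 : forall x : A, (∼ x ⊓ (x^' ⇒ x)) ⇒ (∼ x^') = 1;
  DSN6 : forall x y : A, (x ⊓ y)^' ⇒ (x^' ⊔ y^') = 1;
  DSN7 : forall x y : A, (x^' ⊔ y^') ⇒ (x ⊓ y)^' = 1
}.

(* Main.v *)
(** The hypothesis [z ⇒ ∼ 1 = 1] yields [z ⇒_N ∼ 1 = 1] by (SN11), and then
    (SN6) gives [z = z ⊓ ∼ z]. It holds for [z = 1^'] by (DSN2) and for
    [z = ∼ 1^'] by (DSN4) at [x = 1], since [∼ 1] is the least element. Hence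
    each of [1^'] and [∼ 1^'] lies below the other. *)
From Stdlib Require Import Setoid.
Require Import Defs.

Section SemiNelson.

Context {A : sn_signature} (hA : is_semi_Nelson A).

(** With [m = x ⊓ x], (SN1) and (SN2) give [m ⊔ m = x], and absorption of [m] in [m ⊔ m] then gives
    [m ⊓ x = m]. *)
Lemma meet_idem (x : A) : x ⊓ x = x.
Proof.
  assert (h : (x ⊓ x) ⊔ (x ⊓ x) = x) by now rewrite <- SN2, SN1.
  assert (h' : (x ⊓ x) ⊓ x = x ⊓ x).
  { rewrite <- h at 3. now rewrite SN1. }
  rewrite <- h at 2. now rewrite SN2, h', h.
Qed.

Lemma neg_join (x y : A) : ∼ (x ⊔ y) = ∼ x ⊓ ∼ y.
Proof.
  rewrite <- (SN3 _ hA (∼ x ⊓ ∼ y)), SN4 by assumption.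
  now rewrite !SN3.
Qed.

Lemma neg_inj (x y : A) : ∼ x = ∼ y -> x = y.
Proof. intro h. now rewrite <- (SN3 _ hA x), h, SN3. Qed.

Lemma join_idem (x : A) : x ⊔ x = x.
Proof. apply neg_inj. now rewrite neg_join, meet_idem. Qed.

(** (SN2) swaps the factors as it distributes. *)
Lemma meet_comm (x y : A) : x ⊓ y = y ⊓ x.
Proof. rewrite <- (join_idem y) at 1. now rewrite SN2, join_idem. Qed.

Lemma join_comm (x y : A) : x ⊔ y = y ⊔ x.
Proof. apply neg_inj. now rewrite !neg_join, meet_comm. Qed.

Lemma join_meet_absorb (x y : A) : x ⊔ (x ⊓ y) = x.
Proof. apply neg_inj. now rewrite neg_join, SN4, SN1. Qed.

Lemma impN_refl (x : A) : x ⇒_N x = x ⇒ x.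
Proof. unfold impN. now rewrite meet_idem. Qed.

Lemma meet_imp_refl (x : A) : x ⊓ (x ⇒ x) = x.
Proof. now rewrite <- impN_refl, SN6, join_comm, SN1. Qed.

(** This is (SN8) with all variables equal, its repeated antecedents merged by (SN7). *)
Lemma imp_refl_impN_refl (x : A) : (x ⇒ x) ⇒_N (x ⇒ x) = 1.
Proof.
  pose proof (SN8 _ hA x x x) as h.
  rewrite impN_refl in h.
  now rewrite SN7, meet_idem, SN7, meet_idem in h.
Qed.

(* [x] lies below [x ⇒ x], which lies below [1]. *)
Lemma meet_one (x : A) : x ⊓ 1 = x.
Proof.
  assert (he : (x ⇒ x) ⊓ 1 = x ⇒ x).
  (* With [e = x ⇒ x], [1] is [e ⇒_N e = e ⇒ e], so [meet_imp_refl] applies to [e]. *)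
  { now rewrite <- (imp_refl_impN_refl x), impN_refl, meet_imp_refl. }
  assert (h1 : 1 ⊔ (x ⇒ x) = 1).
  { now rewrite <- he, meet_comm, join_meet_absorb. }
  rewrite <- h1, SN2 by assumption.
  now rewrite (meet_comm (x ⇒ x)), meet_imp_refl, (meet_comm 1), join_meet_absorb.
Qed.

Lemma neg_one_meet (x : A) : ∼ 1 ⊓ x = ∼ 1.
Proof.
  apply neg_inj.
  now rewrite SN4, SN3, <- (meet_one (∼ x)), meet_comm, join_meet_absorb.
Qed.

Lemma meet_neg_of_imp_neg_one (z : A) : z ⇒ ∼ 1 = 1 -> z ⊓ ∼ z = z.
Proof.
  intro h.
  pose proof (SN11 _ hA z (∼ 1)) as h'.
  rewrite h, SN3, meet_one in h' by assumption.
  pose proof (SN6 _ hA z (∼ 1)) as h6.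
  (* The join [∼ z ⊔ ∼ 1] is [∼ (z ⊓ 1)], that is, [∼ z]. *)
  now rewrite h', <- SN4, meet_one in h6.
Qed.

End SemiNelson.

Theorem proposition4p5 (A : dhsn_signature)
    (hA : is_dually_hemimorphic_semi_Nelson A) :
  centered A /\ is_center A (1^').
Proof.
  pose proof (dhsn_semi_Nelson _ hA) as hS.
  assert (hc : is_center A (1^')).
  { unfold is_center.
    pose proof (meet_neg_of_imp_neg_one hS _ (DSN2 _ hA)) as h1.
    pose proof (DSN4 _ hA 1) as h4.
    rewrite (neg_one_meet hS) in h4.
    pose proof (meet_neg_of_imp_neg_one hS _ h4) as h2.
    (* By involution and commutativity, [h2] concerns the same meet as [h1]. *)
    rewrite (SN3 _ hS), (meet_comm hS) in h2.
    now rewrite <- h2, h1. }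
  split; [exists (1^') |]; exact hc.
Qed.
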